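(* Let $n \ge 2$ and let $\lambda=(\lambda_1,\ldots,\lambda_r)$ be a partition of $n$. Then $\eta_\lambda \neq 0$ and \[ \mathrm{sign}(\eta_\lambda) = (-1)^{n-\lambda_1}, \] i.e. $\eta_\lambda$ is positive if the number of cells below the first row of the Ferrers diagram of $\lambda$ is even, and negative if it is odd.
   Context: For $n\ge 1$, $\mathcal{D}_n\subseteq S_n$ denotes the set of derangements (fixed-point-free permutations) of $\{1,\ldots,n\}$. For a partition $\lambda\vdash n$, $\chi_\lambda$ is the irreducible character of $S_n$ indexed by $\lambda$ (standard indexing, $(n)$ the trivial character), and $\eta_\lambda=\frac{1}{\chi_\lambda(1)}\sum_{\sigma\in\mathcal{D}_n}\chi_\lambda(\sigma)$; these are the eigenvalues of the derangement graph, the Cayley graph $\Gamma(S_n,\mathcal{D}_n)$. Partitions are written as weakly decreasing sequences of positive parts; $\mathrm{sign}(x)$ is $1$ for $x>0$ and $-1$ for $x<0$. *)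

(* Defs.v *)
From mathcomp Require Import all_boot all_order all_algebra.
From mathcomp Require Import all_fingroup all_solvable all_field all_character.

Set Implicit Arguments.
Unset Strict Implicit.
Unset Printing Implicit Defensive.

Import GroupScope Order.TTheory GRing.Theory Num.Theory.
Local Open Scope ring_scope.

Definition is_partition (n : nat) (lam : seq nat) : bool :=
  [&& sorted geq lam, all (leq 1) lam & sumn lam == n].

(* The cells of the Ferrers diagram of lam are numbered 0, ..., n - 1 in reading
   order (left to right in each row, rows from top to bottom). Cell k lies in
   row reshape_index lam k and in column reshape_offset lam k, so these are the
   row and column groups of the tableau with entry k in cell k. *)
Definition row_group (n : nat) (lam : seq nat) : {set 'S_n} :=
  [set s : 'S_n | [forall k : 'I_n, reshape_index lam (s k) == reshape_index lam k]].

Definition col_group (n : nat) (lam : seq nat) : {set 'S_n} :=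
  [set s : 'S_n | [forall k : 'I_n, reshape_offset lam (s k) == reshape_offset lam k]].

(* The Young symmetrizer
     (\sum_(p in row_group) p) * (\sum_(q in col_group) sgn(q) q)
   of the group algebra algC['S_n], in coordinates on the basis 'S_n. *)
Definition young_symmetrizer (n : nat) (lam : seq nat) :
    'rV[algC]_#|[set: 'S_n]| :=
  \sum_(p in row_group n lam) \sum_(q in col_group n lam)
    (-1) ^+ q *: delta_mx 0 (gring_index [set: 'S_n] (p * q)%g).

(* The Specht module: the ideal of algC['S_n] generated by the Young
   symmetrizer. It is a right ideal because MathComp representations act on
   row vectors from the right. *)
Definition specht_repr (n : nat) (lam : seq nat) :=
  submod_repr (cyclic_mx_module (regular_repr algC [set: 'S_n])
                 (young_symmetrizer n lam)).

Definition chi (n : nat) (lam : seq nat) : 'CF([set: 'S_n]) :=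
  cfRepr (specht_repr n lam).

Definition derangements (n : nat) : {set 'S_n} :=
  [set s : 'S_n | [forall k : 'I_n, s k != k]].

Definition eta (n : nat) (lam : seq nat) : algC :=
  (chi n lam 1%g)^-1 * \sum_(s in derangements n) chi n lam s.

(* Main.v *)
Require Import Defs.
From mathcomp Require Import all_boot all_order all_algebra.
From mathcomp Require Import all_fingroup all_solvable all_field all_character.

Set Implicit Arguments.
Unset Strict Implicit.
Unset Printing Implicit Defensive.

Import GroupScope Order.TTheory GRing.Theory Num.Theory.
Local Open Scope ring_scope.

(* For a representation V of Sym(n) put b_m = m! * (the sum over |N| = m of the
   dimension of the fixed space V^Sym(N)). Inclusion-exclusion over the fixed
   points gives
     \sum_(s derangement) chi_V s = \sum_m (-1)^(n - m) b_m.
   For the Specht module, b_m = 0 for m > lam_1, as then N has two points in a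
   column. On the other hand b_(m-1) <= b_m for m <= lam_1: a vector v fixed by
   Sym(M) and killed by the symmetrizers of all sets x |: M is killed by the
   symmetrizers of all larger sets N, whereas every nonzero vector of the
   Specht module survives some symmetrizer of a set of size lam_1 (look at its
   value at 1, after a translation). As b_0 = dim V and b_1 = n dim V, the
   alternating sum has the sign of its leading term, of index m = lam_1. *)

Lemma perm_on_tperm (T : finType) (N : {set T}) (x y : T) :
  x \in N -> y \in N -> perm_on N (tperm x y).
Proof.
move=> Nx Ny; apply: subset_trans (tperm_on x y) _.
by apply/subsetP=> z /set2P[]->.
Qed.

Lemma perm_onMr (T : finType) (N : {set T}) (s t : {perm T}) :
  perm_on N t -> perm_on N (s * t)%g = perm_on N s.
Proof.
move=> Nt; apply/idP/idP=> [Nst|Ns]; last exact: perm_onM.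
by rewrite -(mulgK t s) perm_onM ?perm_onV.
Qed.

Lemma perm_onMl (T : finType) (N : {set T}) (s t : {perm T}) :
  perm_on N s -> perm_on N (s * t)%g = perm_on N t.
Proof.
move=> Ns; apply/idP/idP=> [Nst|Nt]; last exact: perm_onM.
by rewrite -(mulKg s t) perm_onM ?perm_onV.
Qed.

Lemma perm_onJ (T : finType) (N : {set T}) (s t : {perm T}) :
  perm_on (t @: N) (s ^ t)%g = perm_on N s.
Proof.
apply/subsetP/subsetP=> sN x; last first.
  rewrite inE -[x](permKV t) permJ (inj_eq perm_inj).
  rewrite mem_imset; last exact: perm_inj.
  exact: sN.
have := sN (t x); rewrite !inE permJ (inj_eq perm_inj) mem_imset //.
exact: perm_inj.
Qed.

Lemma perm_on_setU1 (T : finType) (M : {set T}) (x : T) (s : {perm T}) :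
  x \notin M -> perm_on M s = perm_on (x |: M) s && (s x == x).
Proof.
move=> Mx; apply/idP/andP=> [Ms|[xMs /eqP sx]].
  by rewrite (out_perm Ms) // eqxx /perm_on (subset_trans Ms) ?subsetU1.
apply/subsetP=> y sy; have /setU1P[yx|//] := subsetP xMs _ sy.
by move: sy; rewrite yx inE sx eqxx.
Qed.

Lemma sum_sign_fixed (R : comNzRingType) (T : finType) (s : {perm T}) :
  \sum_(N : {set T} | perm_on N s) (-1) ^+ (#|T| - #|N|)
    = [forall k, s k != k]%:R :> R.
Proof.
transitivity (\prod_(k : T) (1 + - (s k == k)%:R) : R).
  rewrite bigA_distr [LHS]big_mkcond /=; apply: eq_bigr => N _.
  rewrite (bigID [in N]) /= big1 => [|k ->//]; rewrite mul1r.
  have [Ns|] := ifPn.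
    under eq_bigr => k Nk do rewrite (negPf Nk) (out_perm Ns Nk) eqxx.
    by rewrite prodr_const -(cardC N) addKn.
  case/subsetPn=> k; rewrite inE => /negPf sk Nk.
  by rewrite (bigD1 k) //= sk (negPf Nk) oppr0 mul0r.
have [/forallP s_der|] := boolP [forall k, s k != k].
  by rewrite big1 // => k _; rewrite (negPf (s_der k)) subr0.
by rewrite negb_forall => /existsP[k /negPn sk]; rewrite (bigD1 k) //= sk subrr mul0r.
Qed.

Lemma rank_le_sum_rank (F : fieldType) (m d : nat) (I : finType) (P : pred I)
    (A : I -> 'M_d) (U : 'M[F]_(m, d)) :
    (forall v : 'rV_d, (v <= U)%MS -> (forall i, P i -> v *m A i = 0) -> v = 0) ->
  (\rank U <= \sum_(i | P i) \rank (A i))%N.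
Proof.
suff: forall (r : seq I) k (W : 'M[F]_(k, d)),
    (forall v : 'rV_d, (v <= W)%MS ->
       (forall i, i \in r -> P i -> v *m A i = 0) -> v = 0) ->
    (\rank W <= \sum_(i <- r | P i) \rank (A i))%N.
- by move=> H inj; apply: H => v vU v0; apply: inj => // i; apply: v0; rewrite mem_index_enum.
elim=> [|i r IHr] k W inj.
  rewrite big_nil leqn0 mxrank_eq0; apply/eqP/row_matrixP=> j; rewrite row0.
  by apply: inj; rewrite ?row_sub.
rewrite big_cons; case: ifPn => Pi; last first.
  apply: IHr => v vW v0; apply: inj => // j; rewrite inE => /predU1P[->|/v0//].
  by rewrite (negPf Pi).
rewrite -(mxrank_mul_ker W (A i)) leq_add ?mxrankM_maxr //.
apply: IHr => v; rewrite sub_capmx => /andP[vW /sub_kermxP vi] v0.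
by apply: inj => // j; rewrite inE => /predU1P[->//|/v0].
Qed.

Lemma mxtrace_quasi_idem (F : fieldType) (d : nat) (A : 'M[F]_d) (c : nat) :
  A *m A = A *+ c -> \tr A = (c * \rank A)%:R.
Proof.
move=> A2; have [C [R [fullC freeR defA]]]: exists C : 'M_(d, \rank A),
    exists R, [/\ row_full C, row_free R & C *m R = A].
  exists (col_base A), (row_base A).
  by rewrite col_base_full row_base_free mulmx_base.
suff RC : R *m C = c%:R%:M by rewrite -{1}defA mxtrace_mulC RC mxtrace_scalar natrM mulr_natr.
apply: (row_free_inj freeR); apply: (row_full_inj fullC).
have := congr2 mulmx defA defA; rewrite A2 !mulmxA => ->.
by rewrite mul_mx_scalar -scalemxAl scaler_nat defA.
Qed.

Definition sym_op (T : finType) (d : nat)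
    (rG : mx_representation algC [set: {perm T}] d) (N : {set T}) : 'M_d :=
  \sum_(s | perm_on N s) rG s.

Section SymmetrizingOperators.

Variables (T : finType) (d : nat).
Variable rG : mx_representation algC [set: {perm T}] d.
Implicit Types (M N : {set T}) (x y : T).

Local Notation S := (sym_op rG).

Lemma repr_permM s t : rG (s * t)%g = rG s *m rG t.
Proof. by rewrite repr_mxM ?inE. Qed.

Lemma repr_perm_sym_op N s : perm_on N s -> rG s *m S N = S N.
Proof.
move=> Ns; rewrite mulmx_sumr [RHS](reindex_inj (mulgI s)) /=.
by apply: eq_big => t; rewrite ?perm_onMl // repr_permM.
Qed.

Lemma sym_op_repr_perm N s : perm_on N s -> S N *m rG s = S N.
Proof.
move=> Ns; rewrite mulmx_suml [RHS](reindex_inj (mulIg s)) /=.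
by apply: eq_big => t; rewrite ?perm_onMr // repr_permM.
Qed.

Lemma repr_sym_op t N : rG t *m S (t @: N) = S N *m rG t.
Proof.
rewrite mulmx_suml mulmx_sumr (reindex_inj (conjg_inj t)) /=.
apply: eq_big => [s|s _]; first exact: perm_onJ.
by rewrite -!repr_permM conjgE !mulgA mulgV mul1g.
Qed.

Lemma fixed_sym_op m (u : 'M_(m, d)) N :
  (forall s, perm_on N s -> u *m rG s = u) -> u *m S N = u *+ #|N|`!.
Proof.
by move=> uN; rewrite mulmx_sumr (eq_bigr _ uN) sumr_const card_perm.
Qed.

Lemma sym_op_idem N : S N *m S N = S N *+ #|N|`!.
Proof. by apply: fixed_sym_op => s; apply: sym_op_repr_perm. Qed.

Lemma mxtrace_sym_op N : \tr (S N) = (#|N|`! * \rank (S N))%:R.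
Proof. exact: mxtrace_quasi_idem (sym_op_idem N). Qed.

(* Each coset of Sym M in Sym (x |: M) contains exactly one transposition
   tperm x y with y in x |: M (the identity when y = x). *)
Lemma sym_op_setU1 M x : x \notin M ->
  S (x |: M) = S M *m \sum_(y in x |: M) rG (tperm x y).
Proof.
move=> Mx; have xM : x \in x |: M by apply: setU11.
rewrite /sym_op (partition_big (fun s : {perm T} => s x) [in x |: M]) /=; last first.
  by move=> s Ns; rewrite (perm_closed _ Ns).
rewrite mulmx_sumr; apply: eq_bigr => y My.
rewrite mulmx_suml (reindex_inj (mulIg (tperm x y))) /=.
apply: eq_big => [s|s _]; last by rewrite repr_permM.
rewrite perm_onMr ?perm_on_tperm // permM (perm_on_setU1 _ Mx); congr (_ && _).
by rewrite -{2}(tpermL x y) (inj_eq perm_inj).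
Qed.

(* For x in N but not in M, the hypotheses say that the sum over y in x |: M of
   v (x y) is 0. Multiplying by S N, the terms with y in N each give v (S N),
   and the others vanish by induction on #|N :\: M|. *)
Lemma annihilated_sym_op (v : 'rV_d) M :
    (forall s, perm_on M s -> v *m rG s = v) ->
    (forall x, x \notin M -> v *m S (x |: M) = 0) ->
  forall N, (#|M| < #|N|)%N -> v *m S N = 0.
Proof.
move=> vM v0 N; have [k] := ubnP #|N :\: M|; elim: k N => // k IHk N ltNk ltMN.
have /set0Pn[x /setDP[Nx Mx]]: N :\: M != set0.
  by rewrite setD_eq0; apply/negP=> /subset_leq_card; rewrite leqNgt ltMN.
have: \sum_(y in x |: M) v *m rG (tperm x y) *m S N = 0.
  rewrite -mulmx_suml -mulmx_sumr.
  suff /eqP: #|M|`!%:R *: (v *m \sum_(y in x |: M) rG (tperm x y)) = 0.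
    by rewrite scaler_eq0 pnatr_eq0 -leqn0 leqNgt fact_gt0 => /eqP->; rewrite mul0mx.
  by rewrite scalemxAl scaler_nat -(fixed_sym_op vM) -mulmxA -sym_op_setU1 // v0.
rewrite (bigID [in N]) /= [X in _ + X]big1 ?addr0 => [|y /andP[/setU1P[->|My] Ny]].
- under eq_bigr => y /andP[_ Ny].
    rewrite -mulmxA repr_perm_sym_op ?perm_on_tperm //; over.
  rewrite sumr_const => /eqP; rewrite -scaler_nat scaler_eq0 pnatr_eq0 => /orP[|/eqP//].
  by rewrite -leqn0 leqNgt => /negP[]; apply/card_gt0P; exists x; rewrite unfold_in setU11.
- by rewrite Nx in Ny.
pose t := tperm x y; rewrite -mulmxA -[N](_ : t @: (t @: N) = N); last first.
  by rewrite -imset_comp -[RHS]imset_id; apply: eq_imset => z /=; rewrite tpermK.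
rewrite repr_sym_op mulmxA IHk ?mul0mx // ?card_imset //; try exact: perm_inj.
rewrite ltnS in ltNk; apply: leq_trans ltNk; apply: proper_card; apply/properP; split.
  apply/subsetP=> z /setDP[/imsetP[w Nw ->] tM]; rewrite !inE tM /=.
  move: tM; rewrite /t; case: tpermP => [_|wy|//]; last by rewrite wy in Nw; rewrite Nw in Ny.
  by rewrite My.
exists x; first by rewrite !inE Nx Mx.
rewrite !inE Mx /=; apply/imsetP=> -[w Nw /(canLR (tpermK x y))].
by rewrite tpermL => wy; rewrite -wy in Nw; rewrite Nw in Ny.
Qed.

Lemma rank_sym_op_le M L :
    (#|M| < L)%N ->
    (forall v : 'rV_d, v != 0 -> exists2 N : {set T}, #|N| = L & v *m S N != 0) ->
  (\rank (S M) <= \sum_(x | x \notin M) \rank (S (x |: M)))%N.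
Proof.
move=> ltML gen; apply: rank_le_sum_rank => v /submxP[w ->] v0; apply/eqP.
apply/negPn/negP=> /gen[N defL /eqP[]]; rewrite -{}defL in ltML.
apply: annihilated_sym_op ltML => // s Ms.
by rewrite -mulmxA sym_op_repr_perm.
Qed.

Definition sym_total (m : nat) : nat :=
  m`! * \sum_(N : {set T} | #|N| == m) \rank (S N).

Lemma sym_op_small N : (#|N| <= 1)%N -> S N = 1%:M.
Proof.
move=> N1; rewrite /sym_op (bigD1 1%g) /= ?perm_on1 // repr_mx1.
by rewrite big1 ?addr0 // => s /andP[Ns /eqP[]]; apply: perm_on_id Ns N1.
Qed.

Lemma sym_total0 : sym_total 0 = d.
Proof.
rewrite /sym_total fact0 mul1n (big_pred1 set0) => [|N]; last by rewrite cards_eq0.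
by rewrite sym_op_small ?cards0 // mxrank1.
Qed.

Lemma sym_total1 : sym_total 1 = (#|T| * d)%N.
Proof.
rewrite /sym_total mul1n (eq_bigr (fun=> d)) => [|N /eqP N1]; last first.
  by rewrite sym_op_small ?N1 // mxrank1.
by rewrite sum_nat_const -cardsE card_draws bin1.
Qed.

Lemma sum_derangements_trace :
  \sum_(s : {perm T} | [forall k, s k != k]) \tr (rG s)
    = \sum_(m < #|T|.+1) (-1) ^+ (#|T| - m) * (sym_total m)%:R.
Proof.
transitivity (\sum_(N : {set T}) (-1) ^+ (#|T| - #|N|) * \tr (S N)).
  rewrite [LHS]big_mkcond /=.
  under [RHS]eq_bigr => N _ do rewrite /sym_op raddf_sum mulr_sumr.
  rewrite (exchange_big_dep predT) //=; apply: eq_bigr => s _.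
  by rewrite -mulr_suml sum_sign_fixed; case: ifP; rewrite (mul1r, mul0r).
rewrite (partition_big (fun N : {set T} => inord #|N| : 'I_#|T|.+1) predT) //=.
apply: eq_bigr => m _; rewrite /sym_total big_distrr /= natr_sum mulr_sumr.
have inordE (N : {set T}) : (inord #|N| == m) = (#|N| == m).
  by rewrite -val_eqE /= inordK // ltnS max_card.
under [RHS]eq_bigl => N do rewrite -inordE.
by apply: eq_bigr => N; rewrite inordE => /eqP Nm; rewrite mxtrace_sym_op Nm.
Qed.

Lemma sym_total_le m L :
    (m < L)%N ->
    (forall v : 'rV_d, v != 0 -> exists2 N : {set T}, #|N| = L & v *m S N != 0) ->
  (sym_total m <= sym_total m.+1)%N.
Proof.
move=> ltmL gen; rewrite /sym_total factS (mulnC m.+1) -mulnA leq_mul2l; apply/orP; right.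
apply: (@leq_trans (\sum_(M : {set T} | #|M| == m) \sum_(x | x \notin M) \rank (S (x |: M)))).
  by apply: leq_sum => M /eqP Mm; apply: rank_sym_op_le gen; rewrite Mm.
rewrite big_distrr /= [leqRHS](eq_bigr (fun N : {set T} => \sum_(x in N) \rank (S N))); last first.
  by move=> N /eqP<-; rewrite sum_nat_const.
rewrite (exchange_big_dep predT) //= [leqRHS](exchange_big_dep predT) //=.
apply: leq_sum => x _.
rewrite (reindex_onto (fun N => N :\ x) (fun M => x |: M)) /=; last first.
  by move=> M /andP[_ Mx]; rewrite setU1K.
rewrite leq_eqVlt; apply/orP; left; apply/eqP; apply: eq_big => [N|N].
  rewrite setD11 andbT; have [Nx|Nx] := boolP (x \in N).
    by rewrite setD1K // eqxx !andbT (cardsD1 x N) Nx eqSS.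
  rewrite andbF; apply/negP=> /andP[_ /eqP NE].
  by rewrite -NE setU11 in Nx.
by case/andP=> _ /eqP->.
Qed.

End SymmetrizingOperators.

Lemma alternating_sum_gt0 (R : numDomainType) (b : nat -> R) (L : nat) :
    0 < b 0%N -> b 0%N < b 1%N -> (forall m, (m < L)%N -> b m <= b m.+1) ->
  0 < \sum_(m < L.+1) (-1) ^+ (L - m) * b m.
Proof.
move=> b0 b01; have [k] := ubnP L; elim: k L => // k IHk [|[|L]] ltLk bS.
- by rewrite big_ord1 mul1r.
- by rewrite big_ord_recr big_ord1 /= mul1r mulN1r addrC subr_gt0.
rewrite 2!big_ord_recr /= subnn subSnn mul1r mulN1r -addrA.
apply: ltr_wpDr; first by rewrite addrC subr_ge0 bS.
rewrite (eq_bigr (fun m : 'I_L.+1 => (-1) ^+ (L - m) * b m)) => [|m _].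
  by apply: IHk => [|m ltmL]; [exact: (@ltnW L.+1 k) | apply: bS; do 2 apply: leqW].
have lemL : (m <= L)%N by rewrite -ltnS.
by rewrite subSn ?leqW // subSn // !exprS !mulN1r opprK.
Qed.

Lemma sum_derangements_trace_sign (T : finType) (d : nat)
    (rG : mx_representation algC [set: {perm T}] d) (L : nat) :
    (1 < #|T|)%N -> (0 < d)%N ->
    (forall v : 'rV_d, v != 0 ->
       exists2 N : {set T}, #|N| = L & v *m sym_op rG N != 0) ->
    (forall N : {set T}, (L < #|N|)%N -> sym_op rG N = 0) ->
  exists2 c, 0 < c &
    \sum_(s : {perm T} | [forall k, s k != k]) \tr (rG s) = (-1) ^+ (#|T| - L) * c.
Proof.
move=> T_gt1 d_gt0 gen vanish; pose b m := sym_total rG m.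
have leLT: (L <= #|T|)%N.
  suff /gen[N <- _]: const_mx 1 != 0 :> 'rV[algC]_d by apply: max_card.
  by apply/eqP=> /matrixP/(_ 0 (Ordinal d_gt0))/eqP; rewrite !mxE oner_eq0.
exists (\sum_(m < L.+1) (-1) ^+ (L - m) * (b m)%:R).
  apply: (@alternating_sum_gt0 _ (fun m => (b m)%:R)) => [||m ltmL]; rewrite ?ltr_nat ?ler_nat /b.
  - by rewrite ltr0n sym_total0.
  - by rewrite sym_total0 sym_total1 ltn_Pmull.
  - exact: sym_total_le ltmL gen.
rewrite sum_derangements_trace mulr_sumr.
rewrite (big_ord_widen #|T|.+1 (fun m => (-1) ^+ (#|T| - L) * ((-1) ^+ (L - m) * (b m)%:R))) //.
rewrite [RHS]big_mkcond /=; apply: eq_bigr => m _; rewrite ltnS; case: leqP => [lemL|ltLm].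
  by rewrite mulrA -exprD addnBA // subnK.
rewrite /b /sym_total big1 ?muln0 ?mulr0 // => N /eqP Nm.
by rewrite vanish ?mxrank0 ?Nm.
Qed.

Lemma reshape_index_eq0 (sh : seq nat) (k : nat) :
  (k < sumn sh)%N -> (reshape_index sh k == 0%N) = (k < head 0%N sh)%N.
Proof. by case: sh => [|l sh] //= _; rewrite /reshape_index /= subn_eq0; case: ifP. Qed.

Lemma reshape_offset_lt (sh : seq nat) (k : nat) :
  sorted geq sh -> (k < sumn sh)%N -> (reshape_offset sh k < head 0%N sh)%N.
Proof.
move=> sh_sorted lt_k; apply: leq_trans (reshape_offsetP lt_k) _.
rewrite -nth0; apply: (sorted_leq_nth _ _ _ sh_sorted) => //.
- by move=> i j l /= le_ij le_jl; apply: leq_trans le_jl le_ij.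
- by move=> i /=.
- by rewrite inE; case: (sh) lt_k.
- by rewrite inE reshape_indexP.
Qed.

Section SpechtModule.

Variables (n : nat) (lam : seq nat).
Hypothesis lam_part : is_partition n lam.

Local Notation gi := (gring_index [set: 'S_n]).
Local Notation aG := (regular_repr algC [set: 'S_n]).
Local Notation c := (young_symmetrizer n lam).
Local Notation V := (cyclic_mx aG c).
Local Notation rS := (specht_repr n lam).

Let sumn_lam : sumn lam = n.
Proof. by case/and3P: lam_part => _ _ /eqP. Qed.

Let lam_sorted : sorted geq lam.
Proof. by case/and3P: lam_part. Qed.

Lemma row_groupP (s : 'S_n) :
  reflect (forall k, reshape_index lam (s k) = reshape_index lam k)
          (s \in row_group n lam).
Proof. by rewrite inE; apply: 'forall_eqP. Qed.

Lemma col_groupP (s : 'S_n) :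
  reflect (forall k, reshape_offset lam (s k) = reshape_offset lam k)
          (s \in col_group n lam).
Proof. by rewrite inE; apply: 'forall_eqP. Qed.

Lemma row_groupMl (s t : 'S_n) :
  s \in row_group n lam -> ((s * t)%g \in row_group n lam) = (t \in row_group n lam).
Proof.
move=> /row_groupP Rs; apply/row_groupP/row_groupP=> Rt k; last by rewrite permM Rt.
by have := Rt (s^-1%g k); rewrite permM permKV => ->; rewrite -{2}[k](permKV s) Rs.
Qed.

Lemma col_groupMr (s t : 'S_n) :
  t \in col_group n lam -> ((s * t)%g \in col_group n lam) = (s \in col_group n lam).
Proof.
move=> /col_groupP Ct; apply/col_groupP/col_groupP=> Cs k.
  by have := Cs k; rewrite permM Ct.
by rewrite permM Ct.
Qed.

Lemma row_colI (s : 'S_n) :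
  s \in row_group n lam -> s \in col_group n lam -> s = 1%g.
Proof.
move=> /row_groupP Rs /col_groupP Cs; apply/permP=> k; rewrite perm1; apply: ord_inj.
by rewrite -[LHS](reshape_indexK lam) Rs Cs reshape_indexK.
Qed.

Lemma gring_index_eq (g h : 'S_n) : (gi g == gi h) = (g == h).
Proof.
apply/eqP/eqP=> [/(congr1 enum_val)|->//].
by rewrite !gring_indexK ?inE.
Qed.

Lemma regular_mul_coef (u : 'rV[algC]_#|[set: 'S_n]|) (g h : 'S_n) :
  (u *m aG h) 0 (gi g) = u 0 (gi (g * h^-1)%g).
Proof.
rewrite mxE (bigD1 (gi (g * h^-1)%g)) //= big1 => [|i ne_i].
  by rewrite !mxE gring_indexK ?inE // mulgKV !eqxx mulr1 addr0.
rewrite !mxE eqxx /=; case: eqP => [/(congr1 enum_val)|]; last by rewrite mulr0.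
rewrite !gring_indexK ?inE // => def_g; case/eqP: ne_i.
by rewrite def_g mulgK gring_valK.
Qed.

Lemma delta_mul_regular (g h : 'S_n) :
  delta_mx 0 (gi g) *m aG h = delta_mx 0 (gi (g * h)%g) :> 'rV[algC]_#|[set: 'S_n]|.
Proof. by rewrite -rowE rowK gring_indexK ?inE. Qed.

Lemma young_symmetrizer1 : c 0 (gi 1%g) = 1.
Proof.
have R1 : 1%g \in row_group n lam by apply/row_groupP=> k; rewrite perm1.
have C1 : 1%g \in col_group n lam by apply/col_groupP=> k; rewrite perm1.
rewrite /young_symmetrizer summxE (bigD1 1%g) //= summxE (bigD1 1%g) //=.
rewrite !big1 ?addr0 => [|p /andP[Rp p1]|q /andP[Cq q1]].
- by rewrite !mxE mulg1 odd_perm1 !eqxx mulr1.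
- rewrite summxE big1 // => q Cq; rewrite !mxE /= gring_index_eq eq_sym.
  case: eqP => [pq1|]; rewrite ?mulr0 //; case/eqP: p1.
  apply: row_colI => //; rewrite -(col_groupMr _ Cq) pq1; exact: C1.
- by rewrite !mxE /= gring_index_eq eq_sym mul1g (negPf q1) mulr0.
Qed.

Lemma young_symmetrizer_row_left (p g : 'S_n) :
  p \in row_group n lam -> c 0 (gi (p * g)%g) = c 0 (gi g).
Proof.
move=> Rp; rewrite /young_symmetrizer !summxE (reindex_inj (mulgI p)) /=.
apply: eq_big => [s|s _]; first exact: row_groupMl.
rewrite !summxE; apply: eq_bigr => q _.
by rewrite !mxE !gring_index_eq -mulgA (inj_eq (mulgI p)).
Qed.

Lemma young_symmetrizer_col_right (x y : 'I_n) :
    x != y -> reshape_offset lam x = reshape_offset lam y ->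
  c *m aG (tperm x y) = - c.
Proof.
move=> ne_xy eq_xy; have Ct : tperm x y \in col_group n lam.
  by apply/col_groupP=> k; case: tpermP => [->|->|].
rewrite /young_symmetrizer mulmx_suml -sumrN; apply: eq_bigr => p _.
rewrite mulmx_suml -sumrN [RHS](reindex_inj (mulIg (tperm x y))) /=.
apply: eq_big => [q|q _]; first by rewrite col_groupMr.
rewrite -scalemxAl delta_mul_regular odd_permM odd_tperm ne_xy mulgA.
by rewrite signr_addb mulrN1 scaleNr opprK.
Qed.

Lemma specht_row_left (u : 'rV[algC]_#|[set: 'S_n]|) (p g : 'S_n) :
  (u <= V)%MS -> p \in row_group n lam -> u 0 (gi (p * g)%g) = u 0 (gi g).
Proof.
case/cyclic_mxP=> A /envelop_mxP[a ->] -> Rp.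
rewrite mulmx_sumr !summxE; apply: eq_bigr => h _.
have entryE j : (c *m (a h *: aG h)) 0 j = a h * (c *m aG h) 0 j.
  by rewrite -scalemxAr mxE.
by rewrite !entryE !regular_mul_coef -mulgA (young_symmetrizer_row_left _ Rp).
Qed.

Lemma young_symmetrizer_sym_op (N : {set 'I_n}) :
  (head 0%N lam < #|N|)%N -> c *m sym_op aG N = 0.
Proof.
move=> ltN; have [x [y [Nx Ny ne_xy eq_xy]]]: exists x, exists y,
    [/\ x \in N, y \in N, x != y & reshape_offset lam x = reshape_offset lam y].
  suff /dinjectivePn[x Nx [y /andP[ne_yx Ny] eq_xy]]:
      ~~ dinjectiveb (fun k : 'I_n => reshape_offset lam k) N.
    by exists x, y; rewrite Nx eq_sym.
  apply: contraL ltN => inj_off; rewrite -leqNgt cardE -(size_iota 0 (head 0%N lam)).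
  rewrite -(size_map (fun k : 'I_n => reshape_offset lam k)).
  apply: uniq_leq_size inj_off _ => _ /mapP[k _ ->].
  by rewrite mem_iota add0n reshape_offset_lt // sumn_lam.
have := congr1 (mulmx c) (repr_perm_sym_op aG (perm_on_tperm Nx Ny)).
rewrite mulmxA young_symmetrizer_col_right // mulNmx => /eqP.
by rewrite -subr_eq0 -opprD oppr_eq0 -mulr2n -scaler_nat scaler_eq0 pnatr_eq0 => /eqP.
Qed.

Lemma val_submod_mul (w : 'rV_(\rank V)) (s : 'S_n) :
  val_submod (w *m rS s) = val_submod w *m aG s.
Proof. by apply: val_submodJ; rewrite inE. Qed.

Lemma val_submod_sym_op (w : 'rV_(\rank V)) (N : {set 'I_n}) :
  val_submod (w *m sym_op rS N) = val_submod w *m sym_op aG N.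
Proof.
rewrite !mulmx_sumr linear_sum; apply: eq_bigr => s _.
exact: val_submod_mul.
Qed.

Lemma specht_sym_op_eq0 (N : {set 'I_n}) :
  (head 0%N lam < #|N|)%N -> sym_op rS N = 0.
Proof.
move=> ltN; apply/row_matrixP=> i; rewrite rowE row0; apply: val_submod_inj.
rewrite val_submod_sym_op linear0.
have /cyclic_mxP[A /envelop_mxP[a ->] ->] := val_submodP (delta_mx 0 i : 'rV_(\rank V)).
rewrite [c *m _]mulmx_sumr mulmx_suml big1 // => g _.
rewrite -scalemxAr -scalemxAl -mulmxA.
have -> : N = g @: (g^-1%g @: N).
  by rewrite -imset_comp -[LHS]imset_id; apply: eq_imset => z /=; rewrite permKV.
rewrite repr_sym_op mulmxA young_symmetrizer_sym_op ?mul0mx ?scaler0 //.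
by rewrite card_imset //; apply: perm_inj.
Qed.

Lemma card_first_row : #|[set k : 'I_n | reshape_index lam k == 0%N]| = head 0%N lam.
Proof.
have le_head : (head 0 lam <= n)%N by rewrite -sumn_lam; case: (lam) => //= l s; rewrite leq_addr.
transitivity #|[set widen_ord le_head i | i in 'I_(head 0%N lam)]|; last first.
  by rewrite card_imset ?card_ord // => i j /(congr1 val) /= /val_inj.
congr #|pred_of_set _|; apply/setP=> k; rewrite inE reshape_index_eq0 ?sumn_lam //.
apply/idP/imsetP=> [ltk|[i _ ->]]; last exact: (ltn_ord i).
by exists (Ordinal ltk) => //; apply: val_inj.
Qed.

Lemma specht_sym_op_neq0 (v : 'rV_(\rank V)) :
  v != 0 -> exists2 N : {set 'I_n}, #|N| = head 0%N lam & v *m sym_op rS N != 0.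
Proof.
move=> nz_v; have [g nz_vg]: exists g, val_submod v 0 (gi g) != 0.
  have /rV0Pn[j nz_vj]: val_submod v != 0.
    by apply: contraNneq nz_v => v0; apply/eqP/val_submod_inj; rewrite v0 linear0.
  by exists (enum_val j); rewrite gring_valK.
pose N0 := [set k : 'I_n | reshape_index lam k == 0%N].
exists (g @: N0); first by rewrite card_imset ?card_first_row //; apply: perm_inj.
have NK : g^-1%g @: (g @: N0) = N0.
  by rewrite -imset_comp -[RHS]imset_id; apply: eq_imset => z /=; rewrite permK.
suff: v *m rS g^-1%g *m sym_op rS N0 != 0.
  by rewrite -mulmxA -{1}NK repr_sym_op mulmxA; apply: contraNneq => ->; rewrite mul0mx.
set u := v *m _.
have Vu : (val_submod u <= V)%MS by apply: val_submodP.
have nz_u : val_submod u 0 (gi 1%g) != 0.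
  by rewrite /u val_submod_mul regular_mul_coef mul1g invgK.
apply: contraNneq nz_u => /(congr1 val_submod).
rewrite val_submod_sym_op linear0 mulmx_sumr => /matrixP/(_ 0 (gi 1%g)).
rewrite summxE mxE (eq_bigr (fun=> val_submod u 0 (gi 1%g))) => [|s Ns].
  by rewrite sumr_const card_perm => /eqP; rewrite mulrn_eq0 -leqn0 leqNgt fact_gt0.
rewrite regular_mul_coef mul1g -[s^-1%g]mulg1 specht_row_left //.
apply/row_groupP=> k; have [|/out_perm->//] := boolP (k \in N0); last exact: perm_onV.
move=> N0k; have := N0k; rewrite -(perm_closed k (perm_onV Ns)) !inE => /eqP->.
by move: N0k; rewrite inE => /eqP.
Qed.

Lemma specht_degree_gt0 : (0 < \rank V)%N.
Proof.
rewrite lt0n mxrank_eq0; apply/eqP=> V0; have := cyclic_mx_id aG c.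
rewrite V0 submx0 => /eqP c0; have /eqP := young_symmetrizer1.
by rewrite c0 mxE eq_sym oner_eq0.
Qed.

End SpechtModule.

(* Num.sg is also 1 on non-real elements of algC, hence the reality clause. *)
Theorem theorem1p2 (n : nat) (lam : seq nat) :
  (2 <= n)%N -> is_partition n lam ->
  [/\ eta n lam \is Num.real,
      eta n lam != 0
    & Num.sg (eta n lam) = (-1) ^+ (n - head 0 lam)%N].
Proof.
move=> n_ge2 lam_part; set r := \rank (cyclic_mx (regular_repr algC [set: 'S_n])
  (young_symmetrizer n lam)).
have r_gt0 : (0 < r)%N := specht_degree_gt0 n lam.
have [|//|v|N|c c_gt0 def_c] :=
    @sum_derangements_trace_sign _ r (specht_repr n lam) (head 0%N lam).
- by rewrite card_ord.
- exact: specht_sym_op_neq0.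
- exact: specht_sym_op_eq0.
have -> : eta n lam = (-1) ^+ (n - head 0 lam)%N * (r%:R^-1 * c).
  rewrite /eta cfRepr1 -/r mulrCA; congr (_ * _).
  rewrite card_ord in def_c; rewrite -def_c; apply: eq_big => s; first by rewrite inE.
  by move=> _; rewrite cfunE inE.
have rc_gt0 : 0 < r%:R^-1 * c by rewrite mulr_gt0 ?invr_gt0 ?ltr0n.
split.
- by rewrite rpredMsign gtr0_real.
- by rewrite mulf_neq0 ?signr_eq0 ?lt0r_neq0.
rewrite -signr_odd; case: odd; rewrite (mul1r, mulN1r); last exact: gtr0_sg.
by rewrite ltr0_sg ?oppr_lt0.
Qed.
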